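(* Let $N$ be a Poisson process on $[0,\infty)$ with intensity $\lambda>0$, with points $0<X_1<X_2<\cdots$, and let $\epsilon>0$, $L>0$. Define $G(-1)=e^{-\lambda L}$ and, for integers $k\ge0$, $$G(k)=(-1)^k\left(e^{-k\lambda\epsilon}\sum_{j=0}^k\frac{[\lambda(k\epsilon-L)]^j}{j!}-e^{-\lambda L}\right)\mathbf{1}_{\{L>k\epsilon\}}.$$ Then for every integer $n\ge0$, $$\Pr(\beta_0'(L)=n)=\sum_{i=n}^{\lfloor L/\epsilon\rfloor+1}(-1)^{i+n}\binom{i}{n}\big(G(i-1)+G(i)\big).$$
   Context: A cluster is a maximal set of consecutive points $X_j,\dots,X_k$ with $X_{l+1}-X_l\le\epsilon$ for $j\le l<k$. $\beta_0'(L)$ denotes the number of incomplete clusters in $[0,L]$, i.e. the number of clusters having at least one point in $[0,L]$ (equivalently, whose first point is $\le L$). *)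

(* Defs.v *)
From HB Require Import structures.
From mathcomp Require Import all_boot all_order all_algebra.
From mathcomp Require Import all_classical all_reals all_analysis.
From mathcomp Require Import exponential_distribution.

Set Implicit Arguments.
Unset Strict Implicit.
Unset Printing Implicit Defensive.

Import Order.TTheory GRing.Theory Num.Theory.
Local Open Scope classical_set_scope.
Local Open Scope ring_scope.

Definition mutually_independent_RVs {d} {T : measurableType d} {R : realType}
  (P : probability T R) (E : nat -> T -> R) : Prop :=
  forall (s : seq nat) (B : nat -> set R), uniq s ->
    (forall j, measurable (B j)) ->
    P (\big[setI/setT]_(j <- s) (E j @^-1` B j)) =
    (\prod_(j <- s) P (E j @^-1` B j))%E.

(* A Poisson process on [0,oo) with intensity lam, given by its arrival times
   X 0 < X 1 < ... (X k is the paper's X_{k+1}): the inter-arrival times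
   E 0 = X 0, E (k+1) = X (k+1) - X k are i.i.d. Exponential(lam). *)
Definition poisson_process_points {d} {T : measurableType d} {R : realType}
  (P : probability T R) (lam : R) (X : nat -> T -> R) : Prop :=
  exists E : nat -> T -> R,
    [/\ (forall j, measurable_fun setT (E j)),
        (forall j (A : set R), measurable A ->
            P (E j @^-1` A) = exponential_prob lam A),
        mutually_independent_RVs P E &
        (forall k w, X k w = \sum_(i < k.+1) E i w)].

(* Index k (0-based) is the first point of a cluster (points at distance <= eps
   are consecutive in a cluster) and that first point lies in [0, L]. *)
Definition cluster_start_le {T} {R : realType} (X : nat -> T -> R)
  (eps L : R) (w : T) (k : nat) : Prop :=
  X k w <= L /\ (k = 0%N \/ eps < X k w - X k.-1 w).

Definition beta0'_eq {T} {R : realType} (X : nat -> T -> R) (eps L : R)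
  (n : nat) : set T :=
  [set w | exists s : seq nat,
     [/\ uniq s, size s = n &
         forall k, k \in s <-> cluster_start_le X eps L w k]].

(* The function G of the statement; G(-1) = e^{-lam L}, and G is set to 0
   for integers < -1 (never used). *)
Definition Gfun {R : realType} (lam eps L : R) (k : int) : R :=
  match k with
  | Negz 0 => expR (- (lam * L))
  | Negz _ => 0
  | Posz k =>
      if k%:R * eps < L then
        (-1) ^+ k *
        (expR (- (k%:R * lam * eps)) *
           (\sum_(j < k.+1) (lam * (k%:R * eps - L)) ^+ j / (j`!)%:R)
         - expR (- (lam * L)))
      else 0
  end.

(* Main.v *)
Require Import Defs.
From HB Require Import structures.
From mathcomp Require Import all_boot all_order all_algebra.
From mathcomp Require Import all_classical all_reals all_analysis.
From mathcomp Require Import exponential_distribution.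
From mathcomp Require Import measurable_realfun ring.

Set Implicit Arguments.
Unset Strict Implicit.
Unset Printing Implicit Defensive.

Import Order.TTheory GRing.Theory Num.Theory.
Import numFieldNormedType.Exports.
Local Open Scope classical_set_scope.
Local Open Scope ring_scope.

(** Let B(u) be the number of points in (0, u] whose preceding gap exceeds eps,
    the origin counting as a point. Its binomial moments are explicit:
    E['C(B(u), i)] = M_i(u) = e^(-i lam eps) (lam (u - i eps))^i / i! for
    u >= i eps (and 0 otherwise), so Newton's forward difference formula suggests
    E[f(r + B(u))] = \sum_i (Delta^i f)(r) M_i(u). Write H(x, r) for this series
    at u = L - x. It is harmonic for the Markov chain (X_k, C_k), where C_k counts
    the cluster starts in [0, L] among the first points: this is the identity
    A_(i+1) + B_i = M_(i+1), where A_i and B_i are the integrals of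
    lam e^(-lam y) M_i(u - y) over 0 < y < u and over eps < y < u. Hence
    E[H(X_k, C_k)] does not depend on k. At the first point it is a combination
    of the A_i(L) = G(i). As k grows, X_k > L with probability tending to 1, and
    then H(X_k, C_k) = f(C_k), which is the indicator of beta0' = n when f is the
    indicator of n. *)

(** * Forward differences and the functions M, A, B *)

Section ForwardDifference.
Context {R : realType}.
Implicit Types (f g : R -> R) (i n : nat).

Definition fdiff f : R -> R := fun r => f (r + 1) - f r.

Definition fdiffn i f : R -> R := iter i fdiff f.

Lemma fdiffnS i f r : fdiffn i.+1 f r = fdiffn i f (r + 1) - fdiffn i f r.
Proof. by []. Qed.

Lemma measurable_fdiffn i f :
  measurable_fun setT f -> measurable_fun setT (fdiffn i f).
Proof.
move=> mf; elim: i => [//|i ih]; apply: measurable_funB => //.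
apply: measurableT_comp => //; apply: measurable_funD => //.
Qed.

Lemma normr_fdiffn i f : (forall r, `|f r| <= 1) ->
  forall r, `|fdiffn i f r| <= 2 ^+ i.
Proof.
move=> f1; elim: i => [|i ih] r; first by rewrite expr0.
rewrite /fdiffn /= /fdiff (le_trans (ler_normB _ _))// exprS mulr_natl mulr2n.
by apply: lerD; exact: ih.
Qed.

(** The test function for the event that the count is [n]. Counts are carried as reals, so that a
    state of the chain lives in [R * R]. *)
Definition at_nat n : R -> R := fun r => (r == n%:R)%:R.

Lemma measurable_at_nat n : measurable_fun setT (at_nat n).
Proof.
rewrite (_ : at_nat n = \1_[set n%:R]); last first.
  apply/funext => r; rewrite indicE /at_nat; congr (nat_of_bool _)%:R.
  by apply/eqP/idP; rewrite inE.
exact: measurable_indic.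
Qed.

Lemma normr_at_nat n r : `|at_nat n r| <= 1.
Proof. by rewrite /at_nat; case: eqP => _; rewrite ?normr1 ?normr0. Qed.

End ForwardDifference.

Section NewtonCoefficients.
Context {R : realType}.

Lemma fdiffn_at_nat_gt (i n c : nat) : (n < c)%N ->
  fdiffn i (@at_nat R n) c%:R = 0.
Proof.
elim: i c => [|i ih] c nc.
  by rewrite /fdiffn /= /at_nat eqr_nat gtn_eqF.
by rewrite fdiffnS natr1 !ih ?subr0// ltnW.
Qed.

(** The offset [c] is kept general for the induction on [i]: passing from [c] to [c + 1] lowers [n]
    by one, and the recursion for differences becomes Pascal's rule. At [c = 0] these are the
    coefficients of the theorem. *)
Lemma fdiffn_at_nat (i n c : nat) :
  fdiffn i (@at_nat R (c + n)) c%:R = (-1) ^+ (i + n) * ('C(i, n))%:R.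
Proof.
elim: i n c => [|i ih] n c.
  rewrite /fdiffn /= /at_nat eqr_nat -{1}[c]addn0 eqn_add2l bin0n eq_sym.
  by case: eqP => [->|]; rewrite ?mulr1 ?mulr0.
rewrite fdiffnS natr1 ih; case: n => [|n].
  rewrite fdiffn_at_nat_gt ?addn0//.
  by rewrite !bin0 exprS sub0r mulN1r mulNr.
rewrite addnS -addSn ih.
rewrite binS natrD !addnS !addSn !exprS.
by ring.
Qed.

End NewtonCoefficients.

Section Primitive.
Context {R : realType}.
Implicit Types (i : nat) (v : R).

(* The primitive of [e^v v^i / i!] vanishing at [0]. *)
Definition Jfun i v : R :=
  (-1) ^+ i * (expR v * (\sum_(j < i.+1) (- v) ^+ j / (j`!)%:R) - 1).

Lemma Jfun0 i : Jfun i 0 = 0.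
Proof.
rewrite /Jfun big_ord_recl expr0 fact0 divr1 big1 ?addr0 => [|j _].
  by rewrite expR0 mulr1 subrr mulr0.
by rewrite oppr0 expr0n mul0r.
Qed.

(** Integration by parts. It drives both the derivative of [Jfun] and the identity [AfunS]. *)
Lemma JfunS i v :
  Jfun i.+1 v = expR v * v ^+ i.+1 / (i.+1`!)%:R - Jfun i v.
Proof.
rewrite /Jfun big_ord_recr /= [in (- v) ^+ _]exprNn.
set S := \sum_(_ < _) _.
have -> : (-1) ^+ i.+1 * (expR v * (S + (-1) ^+ i.+1 * v ^+ i.+1 / (i.+1`!)%:R)
   - 1) = ((-1) ^+ i.+1 * (-1) ^+ i.+1) * (expR v * v ^+ i.+1 / (i.+1`!)%:R)
   - (-1) ^+ i * (expR v * S - 1) by rewrite exprS; ring.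
by rewrite -exprMn mulrNN mulr1 expr1n mul1r.
Qed.

Lemma is_derive_Jfun i v :
  is_derive v 1 (Jfun i) (expR v * v ^+ i / (i`!)%:R).
Proof.
elim: i => [|i ih].
  have -> : Jfun 0 = (fun v => expR v - 1).
    by apply/funext => w; rewrite /Jfun big_ord1 expr0 fact0 divr1 mulr1 mul1r.
  rewrite expr0 fact0 divr1 mulr1.
  by apply: is_derive_eq; rewrite subr0.
have -> : Jfun i.+1 =
    ((i.+1`!)%:R^-1 \*: (expR * (id ^+ i.+1)) : R -> R) - Jfun i.
  apply/funext => w; rewrite JfunS; congr (_ - _).
  by rewrite mulrC /GRing.scale/=; congr (_ * (_ * _)); rewrite fctE.
apply: is_derive_eq.
have -> : (id ^+ i.+1 : R -> R) v = v ^+ i.+1 by rewrite fctE.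
rewrite factS natrM /GRing.scale/=.
have : (i`!)%:R != 0 :> R by rewrite pnatr_eq0 -lt0n fact_gt0.
have : i.+1%:R != 0 :> R by [].
rewrite exprS; move: (i.+1%:R) (i`!%:R) => a b a0 b0.
by field; rewrite a0 b0.
Qed.

End Primitive.

Section Kernels.
Context {R : realType}.
Variables (lam eps : R).
Hypotheses (heps : 0 < eps).
Implicit Types (i : nat) (u L : R).

Definition Mfun i u : R :=
  if i%:R * eps <= u then
    expR (- (lam * (i%:R * eps))) * (lam * (u - i%:R * eps)) ^+ i / (i`!)%:R
  else 0.

(** The substitution [v = lam (u - i eps - y)] turns the integral of [lam e^(-lam y) M_i(u - y)]
    over [0 < y < u] into this closed form. *)
Definition Afun i u : R :=
  if i%:R * eps <= u then expR (- (lam * u)) * Jfun i (lam * (u - i%:R * eps))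
  else 0.

(** By lack of memory, a gap longer than [eps] costs the factor [e^(-lam eps)] and leaves the length
    [u - eps]. *)
Definition Bfun i u : R :=
  if eps <= u then expR (- (lam * eps)) * Afun i (u - eps) else 0.

Lemma Afun0 u : 0 <= u -> Afun 0 u = 1 - expR (- (lam * u)).
Proof.
move=> u0; rewrite /Afun mul0r u0 subr0 /Jfun big_ord1 expr0 fact0 divr1 mulr1.
by rewrite mul1r mulrBr mulr1 -expRD addNr expR0.
Qed.

Lemma Mfun0 u : 0 <= u -> Mfun 0 u = 1.
Proof.
by move=> u0; rewrite /Mfun mul0r u0 mulr0 oppr0 expR0 expr0 fact0 divr1 mulr1.
Qed.

(** This is [JfunS] at [v = lam (u - (i+1) eps)], multiplied by [e^(-lam u)]. *)
Lemma AfunS i u : Afun i.+1 u = Mfun i.+1 u - Bfun i u.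
Proof.
rewrite /Afun /Bfun /Mfun.
have iE : i.+1%:R * eps = i%:R * eps + eps by rewrite -natr1 mulrDl mul1r.
case: ifPn => [iu|]; last first.
  move=> iu; case: ifPn => _; last by rewrite subrr.
  by rewrite /Afun lerBrDr -iE (negbTE iu) mulr0 subrr.
have ieps : 0 <= i%:R * eps by rewrite mulr_ge0// ltW.
have -> : eps <= u by rewrite (le_trans _ iu)// iE lerDr.
rewrite /Afun lerBrDr -iE iu JfunS mulrBr; congr (_ - _).
  by rewrite !mulrA -expRD; congr (expR _ * _ / _); ring.
by rewrite mulrA -expRD; congr (expR _ * Jfun _ _); ring.
Qed.

Lemma Afun_ge i u : u <= i%:R * eps -> Afun i u = 0.
Proof.
rewrite /Afun => ui; case: ifPn => // iu.
have -> : u = i%:R * eps by apply/eqP; rewrite eq_le ui iu.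
by rewrite subrr mulr0 Jfun0 mulr0.
Qed.

(** Balance of one step. When [a i] is the i-th difference of [f] at the current count, the left
    terms come from a gap overshooting [u], from the count kept, and from the increment due to a
    long gap. The identity follows from [Afun0] and [AfunS]; [A_K(u) = 0] lets the first sum take
    one more term. *)
Lemma sum_AB (a : nat -> R) K u : 0 <= u -> u <= K%:R * eps ->
  a 0%N * expR (- (lam * u)) +
    (\sum_(i < K) a i * Afun i u + \sum_(i < K) a i.+1 * Bfun i u) =
  \sum_(i < K.+1) a i * Mfun i u.
Proof.
move=> u0 uK.
have -> : \sum_(i < K) a i * Afun i u = \sum_(i < K.+1) a i * Afun i u.
  by rewrite big_ord_recr/= Afun_ge// mulr0 addr0.
rewrite big_ord_recl/= [RHS]big_ord_recl/= Afun0// Mfun0//.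
have -> : \sum_(i < K) a (bump 0 i) * Mfun (bump 0 i) u =
    \sum_(i < K) a (bump 0 i) * Afun (bump 0 i) u +
    \sum_(i < K) a i.+1 * Bfun i u.
  rewrite -big_split/=; apply: eq_bigr => i _.
  by rewrite AfunS -mulrDr subrK.
by ring.
Qed.

(** The cut-off is strict in [Gfun] and weak in [Afun]; the two agree because [A_i(i eps) = 0]. *)
Lemma Gfun_nat i L : Gfun lam eps L i%:Z = Afun i L.
Proof.
rewrite /Gfun; have [iL|Li] := ltP; last by rewrite Afun_ge.
rewrite /Afun (ltW iL) /Jfun [RHS]mulrCA; congr (_ * _).
rewrite [RHS]mulrBr mulr1 mulrA -expRD; congr (_ - _); congr (expR _ * _).
  by ring.
by apply: eq_bigr => j _; congr (_ ^+ _ / _); ring.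
Qed.

(** Summation by parts: the terms [G(i-1)] are reindexed, [G(-1)] gives the exponential and [G(K)]
    vanishes. When [a i] is the i-th difference of [f] at 0, [a i.+1 + a i] is the i-th difference
    at 1. *)
Lemma sum_Gfun (a : nat -> R) K L : 0 <= L -> L <= K%:R * eps ->
  \sum_(i < K.+1) a i * (Gfun lam eps L (i%:Z - 1) + Gfun lam eps L i%:Z) =
  a 0%N * expR (- (lam * L)) + \sum_(i < K) (a i.+1 + a i) * Afun i L.
Proof.
move=> L0 LK.
have GS i : Gfun lam eps L (i.+1%:Z - 1) = Afun i L.
  by rewrite -Gfun_nat; congr Gfun; rewrite intS addrC addKr.
rewrite big_ord_recl [Gfun _ _ _ (_ - 1)]/= Gfun_nat.
under eq_bigr do rewrite Gfun_nat GS mulrDr.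
rewrite mulrDr -addrA; congr (_ + _); rewrite big_split/=.
have -> : \sum_(i < K) (a i.+1 + a i) * Afun i L =
    \sum_(i < K) a i.+1 * Afun i L + \sum_(i < K.+1) a i * Afun i L.
  rewrite [in RHS]big_ord_recr/= (@Afun_ge K)// mulr0 addr0 -big_split/=.
  by apply: eq_bigr => i _; rewrite mulrDl.
by rewrite big_ord_recl/= addrCA.
Qed.

End Kernels.

(** * Integration against the exponential law *)

Section ExponentialLaw.
Context {R : realType}.
Variables (lam : R) (nu : probability (measurableTypeR R) R).
(* [exponential_prob lam] is a measure only through a proof of [0 < lam], so the
   law is carried by an arbitrary [nu] that agrees with it. *)
Hypothesis nuE : forall A : set R, measurable A -> nu A = exponential_prob lam A.
Notation mu := (@lebesgue_measure R).

Let mpdf : measurable_fun setT (EFin \o exponential_pdf lam).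
Proof. by apply/measurable_EFinP; exact: measurable_exponential_pdf. Qed.

Lemma exponential_law_dominated : nu `<< mu.
Proof.
apply/null_content_dominatesP => A mA muA0.
rewrite nuE// /exponential_prob null_set_integral//; exact: measurable_funTS.
Qed.

(** The Radon-Nikodym derivative of [nu] and the exponential density have the same integral over
    every measurable set, hence agree almost everywhere. *)
Lemma integral_exponential_law (U : set R) (f : R -> \bar R) :
  measurable U -> nu.-integrable U f ->
  (\int[nu]_(x in U) f x = \int[mu]_(x in U) (f x * (exponential_pdf lam x)%:E))%E.
Proof.
move=> mU intf; have mf := measurable_int _ intf.
rewrite -(Radon_Nikodym_change_of_variables exponential_law_dominated)//=.
have mRN : measurable_fun U (Radon_Nikodym (charge_of_finite_measure nu) mu).
  apply: measurable_funTS; apply: (measurable_int mu).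
  by apply: Radon_Nikodym_integrable; exact: exponential_law_dominated.
apply: ae_eq_integral => //.
- exact: emeasurable_funM.
- by apply: emeasurable_funM => //; exact: measurable_funTS.
- apply: ae_eqe_mul2l; apply: integral_ae_eq => //.
  + apply: (integrableS measurableT) => //.
    by apply: Radon_Nikodym_integrable; exact: exponential_law_dominated.
  + exact: measurable_funTS.
  + move=> A _ mA; rewrite -Radon_Nikodym_integral//=.
      by rewrite nuE.
    exact: exponential_law_dominated.
Qed.

Lemma exponential_law_lt0 : nu `]-oo, 0[%classic = 0%E.
Proof.
rewrite nuE// /exponential_prob integral0_eq// => x /=.
by rewrite in_itv/= => x0; rewrite lt0_exponential_pdf.
Qed.

Lemma exponential_law_set1 (a : R) : nu [set a] = 0%E.
Proof.
have /null_content_dominatesP := exponential_law_dominated; apply => //.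
exact: lebesgue_measure_set1.
Qed.

Lemma exponential_law_le (u : R) : 0 <= u ->
  nu `]-oo, u]%classic = (1 - expR (- (lam * u)))%:E.
Proof.
move=> u0; rewrite (@itv_bndbnd_setU _ _ _ (BLeft 0))//.
rewrite measureU//; last first.
  rewrite -subset0 => x /=; rewrite !in_itv/= => -[x0 /andP[+ _]].
  by rewrite leNgt x0.
rewrite [X in (X + _)%E]exponential_law_lt0 add0e.
have [->|] := eqVneq u 0.
  by rewrite set_itv1 [LHS]exponential_law_set1 mulr0 oppr0 expR0 subrr.
move=> une; rewrite [LHS]nuE// exponential_prob_itv0c ?lt_neqAle ?u0 1?eq_sym ?une//.
by rewrite mulNr.
Qed.

Lemma exponential_law_gt (u : R) : 0 <= u ->
  nu `]u, +oo[%classic = (expR (- (lam * u)))%:E.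
Proof.
move=> u0; rewrite -setCitvl probability_setC// exponential_law_le//.
by rewrite -EFinB subKr.
Qed.

Lemma integrable_exponential_law_continuous (f : R -> R) (a b : R) :
  continuous f -> nu.-integrable `[a, b] (EFin \o f).
Proof.
move=> cf; apply: measurable_bounded_integrable => //.
- by rewrite (le_lt_trans (probability_le1 _ _))// ltry.
- by apply: measurable_funTS; exact: continuous_measurable_fun.
- have /compact_bounded[M [_ hM]] :=
    continuous_compact (continuous_subspaceT cf) (@segment_compact _ a b).
  by exists M; split; rewrite ?num_real// => ? ? ? ?; exact: hM.
Qed.

Lemma continuous_power (i : nat) (b : R) :
  continuous (fun y : R => (lam * (b - y)) ^+ i / (i`!)%:R).
Proof.
move=> y; apply: cvgM; last exact: cvg_cst.
apply: (@continuous_comp _ _ _ (fun y => lam * (b - y)) (fun z => z ^+ i)).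
  by apply: cvgM; [exact: cvg_cst|apply: cvgB; [exact: cvg_cst|exact: cvg_id]].
exact: exprn_continuous.
Qed.

Lemma integral_power_exponential_law (i : nat) (a b : R) : 0 <= a -> a <= b ->
  \int[nu]_(y in `[a, b]) ((lam * (b - y)) ^+ i / (i`!)%:R) =
  expR (- (lam * b)) * Jfun i (lam * (b - a)).
Proof.
(* The fundamental theorem of calculus below needs [a < b]; a single point is a null set. *)
move=> a0; rewrite le_eqVlt => /predU1P[<-|ab].
  rewrite subrr mulr0 Jfun0 mulr0 set_itv1 /Rintegral null_set_integral//.
    exact: measurable_fun_set1.
  exact: exponential_law_set1.
pose p y := (lam * (b - y)) ^+ i / (i`!)%:R.
have cp : continuous p := @continuous_power i b.
pose q y := lam * expR (- (lam * y)) * p y.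
have cq : continuous q.

  move=> y; apply: cvgM; last exact: cp.
  apply: cvgM; first exact: cvg_cst.
  apply: (@continuous_comp _ _ _ (fun y => - (lam * y)) expR); last first.
    exact: continuous_expR.
  by apply: cvgN; apply: cvgM; [exact: cvg_cst|exact: cvg_id].
have intp := integrable_exponential_law_continuous a b cp.
have -> : \int[nu]_(y in `[a, b]) p y =
    fine (\int[mu]_(y in `[a, b]) (q y)%:E)%E.
  congr fine; apply: (etrans (integral_exponential_law _ intp)) => //.
  apply: eq_integral => y; rewrite inE/= in_itv/= => /andP[ay _].
  rewrite exponential_pdfE ?(le_trans a0)// -EFinM; congr EFin.
  by rewrite /q/p -mulNr; ring.
(* This primitive vanishes at [y = b], so only the lower endpoint contributes. *)
pose F y := - (expR (- (lam * b)) * Jfun i (lam * (b - y))).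
have dF (y : R) : is_derive y 1 F (q y).
  have -> : q y = - (expR (- (lam * b)) *
      (expR (lam * (b - y)) * (lam * (b - y)) ^+ i / (i`!)%:R * - lam)).
    rewrite /q /p (_ : - (lam * y) = - (lam * b) + lam * (b - y)); last by ring.
    by rewrite expRD; ring.
  pose g z := lam * (b - z).
  have dg : is_derive y 1 g (- lam).
    have -> : g = lam \*: (cst b - id) by [].
    by apply: is_derive_eq; rewrite sub0r /GRing.scale/= mulrN1.
  have dJ := is_derive1_comp (is_derive_Jfun i (g y)) dg.
  have -> : F = - (expR (- (lam * b)) \*: (Jfun i \o g)) by [].
  by apply: is_derive_eq.
have cF : continuous F.
  by move=> y; apply: differentiable_continuous; apply/derivable1_diffP; have [] := dF y.
rewrite (@continuous_FTC2 _ _ F)//.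
- rewrite /F subrr mulr0 Jfun0 mulr0 oppr0 -EFinB/= sub0r.
  by rewrite opprK.
- exact: continuous_subspaceT.
- split.
  + by move=> y _; have [] := dF y.
  + apply: cvg_at_right_filter; exact: cF.
  + apply: cvg_at_left_filter; exact: cF.
- move=> y _; rewrite derive1E; by have [_ ->] := dF y.
Qed.

End ExponentialLaw.

Lemma Rintegral_sum d (T : measurableType d) (R : realType)
    (mu : {measure set T -> \bar R}) (D : set T) (K : nat) (h : nat -> T -> R) :
  measurable D -> (forall i, mu.-integrable D (EFin \o h i)) ->
  mu.-integrable D (EFin \o (fun x => \sum_(i < K) h i x)) /\
  \int[mu]_(x in D) (\sum_(i < K) h i x) = \sum_(i < K) \int[mu]_(x in D) h i x.
Proof.
move=> mD ih; elim: K => [|K [iK eK]].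
  rewrite big_ord0; have -> : (fun x => \sum_(i < 0) h i x) = cst 0.
    by apply/funext => x; rewrite big_ord0.
  split; first exact: integrable0.
  by rewrite /Rintegral integral0.
have E : (fun x => \sum_(i < K.+1) h i x) =
    (fun x => \sum_(i < K) h i x + h K x).
  by apply/funext => x; rewrite big_ord_recr.
rewrite E big_ord_recr/= RintegralD// eK; split => //.
exact: (integrableD mD iK (ih K)).
Qed.

Section FirstStep.
Context {R : realType}.
Variables (lam eps : R) (nu : probability (measurableTypeR R) R).
Hypothesis eps0 : 0 < eps.
Hypothesis nuE : forall A : set R, measurable A -> nu A = exponential_prob lam A.

(** The function [y |-> M_i(u - y)] restricted to [c <= y]; the cut-off of [Mfun] becomes the right
    endpoint. Its integral is [A_i(u)] for [c = 0] and [B_i(u)] for [c = eps]. *)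
Let q (u : R) (c : R) (i : nat) : R -> R :=
  (fun y => expR (- (lam * (i%:R * eps))) *
     ((lam * (u - i%:R * eps - y)) ^+ i / (i`!)%:R)) \_ `[c, u - i%:R * eps].

Let continuous_q u i : continuous (fun y => expR (- (lam * (i%:R * eps))) *
     ((lam * (u - i%:R * eps - y)) ^+ i / (i`!)%:R)).
Proof. by move=> y; apply: cvgM; [exact: cvg_cst|exact: continuous_power]. Qed.

Let integrable_q u c i : nu.-integrable setT (EFin \o q u c i).
Proof.
rewrite -restrict_EFin; apply/integrable_restrict => //=; rewrite setTI.
exact: (integrable_exponential_law_continuous _ _ _ (@continuous_q u i)).
Qed.

Let integral_q u c i : 0 <= c -> \int[nu]_y q u c i y =
  if c <= u then expR (- (lam * c)) * Afun lam eps i (u - c) else 0.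
Proof.
move=> c0; rewrite -Rintegral_mkcond.
have i0 : 0 <= i%:R * eps by rewrite mulr_ge0// ltW.
have [uc|uc] := leP c (u - i%:R * eps); last first.
  rewrite set_itv_ge ?bnd_simp -?ltNge// Rintegral_set0; case: ifPn => // _.
  rewrite /Afun ifF ?mulr0//; apply/negP; apply/negP; rewrite -ltNge.
  by rewrite ltrBlDr addrC -ltrBlDr.
rewrite RintegralZl//; last first.
  exact: (integrable_exponential_law_continuous _ _ _
    (@continuous_power _ lam i (u - i%:R * eps))).
rewrite integral_power_exponential_law// mulrA -expRD.
have -> : c <= u by rewrite (le_trans uc)// gerBl.
rewrite /Afun ifT; last by rewrite lerBrDr addrC -lerBrDr.
by rewrite [RHS]mulrA -[in RHS]expRD; congr (expR _ * Jfun _ _); ring.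
Qed.

(** A common form for the first point and for every later transition: [u] is the length left before
    [L], [y] the next gap, and [b i] the correction when that gap exceeds [eps]. *)
Lemma integral_first_step (g : R -> R) (a b : nat -> R) (f0 u : R) (K : nat) :
  0 <= u -> measurable_fun setT g ->
  (forall y, u < y -> g y = f0) ->
  (forall y, 0 <= y -> y <= u -> g y =
     \sum_(i < K) (a i + (eps < y)%R%:R * b i) * Mfun lam eps i (u - y)) ->
  \int[nu]_y g y = f0 * expR (- (lam * u)) +
    (\sum_(i < K) a i * Afun lam eps i u + \sum_(i < K) b i * Bfun lam eps i u).
Proof.
move=> u0 mg gu g0u.
pose h y := f0 * \1_(`]u, +oo[%classic : set R) y +
  (\sum_(i < K) a i * q u 0 i y + \sum_(i < K) b i * q u eps i y).
have intq c (w : nat -> R) i : nu.-integrable setT (EFin \o (fun y => w i * q u c i y)).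
  exact: (integrableZl measurableT _ (integrable_q u c i)).
have [ia ea] := Rintegral_sum K measurableT (intq 0 a).
have [ib eb] := Rintegral_sum K measurableT (intq eps b).
have i1 : nu.-integrable setT (EFin \o (\1_(`]u, +oo[%classic : set R) : R -> R)).
  exact: integrable_indic.
have i1' :
    nu.-integrable setT (EFin \o (fun y => f0 * \1_(`]u, +oo[%classic : set R) y)).
  exact: (integrableZl measurableT _ i1).
have ih : nu.-integrable setT (EFin \o h).
  exact: (integrableD measurableT i1' (integrableD measurableT ia ib)).
have -> : \int[nu]_y g y = \int[nu]_y h y.
  congr fine; apply: ae_eq_integral => //.
  - exact/measurable_EFinP.
  - exact: measurable_int ih.
  (* Nothing is assumed of [g] at negative gaps, and at [y = eps] the closed interval in [q] may
     disagree with the strict test [eps < y]. *)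
  exists (`]-oo, 0[ `|` [set eps]); split.
  - exact: measurableU.
  - apply/eqP; rewrite -measure_le0 (le_trans (measureU2 _ _ _))//.
    rewrite [X in (X + _)%E](exponential_law_lt0 nuE) add0e.
    by rewrite [leLHS](exponential_law_set1 nuE).
  move=> y /= /not_implyP[_ gh]; apply: contrapT => /not_orP[y0 ye].
  have {}y0 : 0 <= y by rewrite leNgt; apply/negP => ?; apply: y0; rewrite in_itv.
  apply: gh; congr EFin; rewrite /h indicE.
  have ieps i : 0 <= i%:R * eps by rewrite mulr_ge0// ltW.
  have [uy|yu] := ltP u y.
    rewrite gu// mem_set/= ?in_itv/= ?uy// mulr1 !big1 ?addr0// => i _.
      rewrite /q patchE memNset ?mulr0//= in_itv/= => /andP[_].
      by rewrite leNgt (le_lt_trans _ uy)// gerBl.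
    rewrite /q patchE memNset ?mulr0//= in_itv/= => /andP[_].
    by rewrite leNgt (le_lt_trans _ uy)// gerBl.
  rewrite g0u// memNset/= ?in_itv/= ?andbT; last by apply/negP; rewrite -leNgt.
  rewrite mulr0 add0r -big_split/=; apply: eq_bigr => i _.
  rewrite mulrDl /q !patchE !mem_setE !in_itv/= y0/=.
  have -> : (y <= u - i%:R * eps) = (i%:R * eps <= u - y).
    by rewrite lerBrDr addrC -lerBrDr.
  have -> : (eps <= y) = (eps < y).
    by rewrite le_eqVlt; case: eqP => // ey; case: ye.
  rewrite /Mfun; case: ifPn => _; last by rewrite !andbF !mulr0.
  have -> : lam * (u - i%:R * eps - y) = lam * (u - y - i%:R * eps) by ring.
  rewrite andbT; rewrite (_ : point = 0 :> R)//; case: ifPn => _ /=; ring.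
rewrite /h RintegralD//; last exact: (integrableD measurableT ia ib).
rewrite RintegralD// ea eb RintegralZl//; congr (_ * _ + (_ + _)).
- rewrite /Rintegral integral_indic// setIT.
  by rewrite [X in fine X](exponential_law_gt nuE u0).
- apply: eq_bigr => i _; rewrite RintegralZl// integral_q// u0 mulr0 oppr0 expR0.
  by rewrite mul1r addr0.
- apply: eq_bigr => i _; rewrite RintegralZl// integral_q// ltW//.
Qed.

End FirstStep.

(** * The Markov chain and its harmonic function *)

Section JointLaw.
Local Open Scope ereal_scope.
Context d d1 d2 (T : measurableType d) (T1 : measurableType d1)
  (T2 : measurableType d2) (R : realType) (P : probability T R).
Variables (U : {mfun T >-> T1}) (V : {mfun T >-> T2}).
Hypothesis indepUV : forall A B, measurable A -> measurable B ->
  P ((U @^-1` A) `&` (V @^-1` B)) = P (U @^-1` A) * P (V @^-1` B).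

Let W w := (U w, V w).

Let mW : measurable_fun setT W.
Proof. by apply: measurable_fun_pair => //; exact: measurable_funP. Qed.

Lemma joint_lawE D : measurable D ->
  P (W @^-1` D) = (distribution P U \x distribution P V) D.
Proof.
move=> mD.
have WE A B : measurable A -> measurable B ->
    pushforward P W (A `*` B) = distribution P U A * distribution P V B.
  by move=> mA mB; exact: indepUV.
by rewrite (product_measure_unique WE).
Qed.

(** As measures in [D], both sides agree on rectangles with the product of the law of [U] and the
    law of [V] scaled by [P F]; uniqueness of the product measure extends this to all [D]. *)
Lemma indep_pair_event (F : set T) : measurable F ->
  (forall A B, measurable A -> measurable B ->
    P ((U @^-1` A) `&` (V @^-1` B) `&` F) =
    P (U @^-1` A) * P (V @^-1` B) * P F) ->
  forall D, measurable D -> P ((W @^-1` D) `&` F) = P (W @^-1` D) * P F.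
Proof.
move=> mF UVF D mD.
pose p := NngNum (fine_ge0 (measure_ge0 P F)).
have pE : p%:num%:E = P F by rewrite /= fineK ?fin_num_measure.
have FE A B : measurable A -> measurable B ->
    pushforward (mrestr P mF) W (A `*` B) =
    distribution P U A * mscale p (distribution P V) B.
  move=> mA mB; rewrite /mscale pE muleCA muleC.
  exact: UVF.
have WE A B : measurable A -> measurable B ->
    mscale p (pushforward P W) (A `*` B) =
    distribution P U A * mscale p (distribution P V) B.
  move=> mA mB; rewrite /mscale muleCA; congr (_ * _).
  exact: indepUV.
have := product_measure_unique FE mD; rewrite (product_measure_unique (WE mW) mD).
rewrite /= /mscale/= fineK ?fin_num_measure// muleC => /(_ mW) WF.
exact: esym WF.
Qed.

(** The joint law is the product of the marginals, so Fubini integrates out [V] with [U] frozen. *)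
Lemma integral_indep_pair (g : T1 * T2 -> R) (C : R) :
  measurable_fun setT g -> (forall w, (`|g (U w, V w)| <= C)%R) ->
  \int[P]_w (g (U w, V w))%:E =
  \int[P]_w \int[distribution P V]_y (g (U w, y))%:E.
Proof.
move=> mg gC; set m := distribution P U \x distribution P V.
have mgE : measurable_fun setT (EFin \o g) by exact/measurable_EFinP.
have mgW : measurable_fun setT (g \o W) by exact: measurableT_comp.
have intW : P.-integrable setT ((EFin \o g) \o W).
  apply: measurable_bounded_integrable => //.
    by rewrite (le_lt_trans (probability_le1 _ _))// ltry.
  by exists C; split; rewrite ?num_real// => M CM w _; exact: le_trans (gC w) (ltW CM).
have eqm (h : T1 * T2 -> \bar R) : \int[pushforward P W]_z h z = \int[m]_z h z.
  by apply: eq_measure_integral => A mA _; exact: joint_lawE.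
have intm : m.-integrable setT (EFin \o g).
  apply/integrableP; split=> //; rewrite -eqm.
  have /integrableP[_] := integrable_pushforward mW mgE intW measurableT.
  by [].
have -> : \int[P]_w (g (U w, V w))%:E = \int[m]_z (g z)%:E.
  by rewrite -eqm integral_pushforward.
rewrite -integral12_prod_meas1//.
have mF := measurable_fubini_F intm.
have iF := integrable_fubini_F intm.
rewrite integral_distribution//.
apply/integrableP; split; first exact: measurableT_comp.
move/integrableP : iF => [_]; rewrite ge0_integral_distribution//.
exact: measurableT_comp.
Qed.

End JointLaw.

Section Remaining.
Context {R : realType}.
Variables (lam eps L : R) (f : R -> R) (K : nat).
Hypotheses (lam0 : 0 < lam) (eps0 : 0 < eps) (L0 : 0 < L) (LK : L < K%:R * eps).
Hypotheses (mf : measurable_fun setT f) (f1 : forall r, `|f r| <= 1).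

Definition step (z : R * R) (y : R) : R * R :=
  (z.1 + y, if (eps < y) && (z.1 + y <= L) then z.2 + 1 else z.2).

(* Truncating the Newton series at [K] is harmless: [M_i(u) = 0] for
   [u <= L < K eps] and [i >= K]. *)
Definition newton (z : R * R) : R :=
  if (0 <= z.1) && (z.1 <= L)
  then \sum_(i < K) fdiffn i f z.2 * Mfun lam eps i (L - z.1)
  else f z.2.

Lemma measurable_step : measurable_fun setT (fun zy => step zy.1 zy.2).
Proof.
have m1 : measurable_fun setT (fun zy : (R * R) * R => zy.1.1 + zy.2).
  apply: measurable_funD; last exact: measurable_snd.
  by apply: measurableT_comp; [exact: measurable_fst|exact: measurable_fst].
have m2 : measurable_fun setT (fun zy : (R * R) * R => zy.1.2).
  by apply: measurableT_comp; [exact: measurable_snd|exact: measurable_fst].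
apply: measurable_fun_pair => //.
apply: measurable_fun_ifT => //; last exact: measurable_funD.
apply: measurable_and; first exact: measurable_fun_ltr.
exact: measurable_fun_ler.
Qed.

Lemma measurable_init :
  measurable_fun setT (fun y : R => (y, (y <= L)%R%:R) : R * R).
Proof.
apply: measurable_fun_pair => //.
have -> : (fun y : R => (y <= L)%R%:R) = (fun y : R => if y <= L then 1 else 0 : R).
  by apply/funext => y; case: (y <= L).
by apply: measurable_fun_ifT => //; exact: measurable_fun_ler.
Qed.

Lemma measurable_Mfun i : measurable_fun setT (Mfun lam eps i).
Proof.
apply: measurable_fun_ifT => //; first exact: measurable_fun_ler.
apply: measurable_funM => //; apply: measurable_funM => //.
apply: measurable_funX; apply: measurable_funM => //; exact: measurable_funB.
Qed.

Lemma measurable_newton : measurable_fun setT newton.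
Proof.
apply: measurable_fun_ifT.
- apply: measurable_and; apply: measurable_fun_ler => //; exact: measurable_fst.
- apply: measurable_sum => i; apply: measurable_funM.
    by apply: measurableT_comp; [exact: measurable_fdiffn|exact: measurable_snd].
  apply: measurableT_comp; first exact: measurable_Mfun.
  by apply: measurable_funB => //; exact: measurable_fst.
- by apply: measurableT_comp => //; exact: measurable_snd.
Qed.

Lemma normr_Mfun i u : u <= L -> `|Mfun lam eps i u| <= (lam * L) ^+ i.
Proof.
move=> uL; rewrite /Mfun; case: ifPn => [iu|_]; last first.
  by rewrite normr0 exprn_ge0// mulr_ge0// ltW.
have i0 : 0 <= i%:R * eps by rewrite mulr_ge0// ltW.
have v0 : 0 <= lam * (u - i%:R * eps) by rewrite mulr_ge0 ?subr_ge0// ltW.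
rewrite ger0_norm; last by rewrite !mulr_ge0 ?expR_ge0 ?exprn_ge0.
rewrite ler_pdivrMr ?ltr0n ?fact_gt0//.
have e1 : expR (- (lam * (i%:R * eps))) <= 1.
  by rewrite -[leRHS]expR0 ler_expR oppr_le0 mulr_ge0// ltW.
have vL : lam * (u - i%:R * eps) <= lam * L.
  by rewrite ler_pM2l// (le_trans _ uL)// gerBl.
rewrite (le_trans (ler_piMl (exprn_ge0 _ v0) e1))//.
rewrite (le_trans (lerXn2r i v0 (le_trans v0 vL) vL))//.
by rewrite ler_peMr ?exprn_ge0 ?(le_trans v0)// ler1n fact_gt0.
Qed.

Lemma newton_bounded : exists C, forall z, `|newton z| <= C.
Proof.
exists (\sum_(i < K) 2 ^+ i * (lam * L) ^+ i + 1) => z; rewrite /newton.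
have S0 : 0 <= \sum_(i < K) 2 ^+ i * (lam * L) ^+ i :> R.
  by rewrite sumr_ge0// => i _; rewrite mulr_ge0 ?exprn_ge0// mulr_ge0// ltW.
case: ifPn => [/andP[z0 zL]|_]; last by rewrite (le_trans (f1 _))// lerDr.
apply: (le_trans (ler_norm_sum _ _ _)); rewrite -[leLHS]addr0 lerD//.
apply: ler_sum => i _; rewrite normrM ler_pM//; first exact: normr_fdiffn.
by apply: normr_Mfun; rewrite gerBl.
Qed.

Variable nu : probability (measurableTypeR R) R.
Hypothesis nuE : forall A : set R, measurable A -> nu A = exponential_prob lam A.

Lemma Mfun_ge i u : u < i%:R * eps -> Mfun lam eps i u = 0.
Proof. by rewrite /Mfun ltNge; case: ifP. Qed.

Lemma newton_harmonic z : 0 <= z.1 -> \int[nu]_y newton (step z y) = newton z.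
Proof.
move=> z0; have mg : measurable_fun setT (fun y => newton (step z y)).
  apply: measurableT_comp; first exact: measurable_newton.
  exact: (measurableT_comp measurable_step (measurable_pair1 z)).
have [zL|Lz] := leP z.1 L; last first.
  have big y : 0 <= y -> newton (step z y) = f z.2.
    move=> y0; rewrite /newton/step/=.
    have h : (z.1 + y <= L) = false.
      by apply/negbTE; rewrite -ltNge (lt_le_trans Lz)// lerDl.
    by rewrite h !andbF.
  (* Beyond [L] the count is frozen: the integrand is the constant [f z.2] on nonnegative gaps,
     which is the case [u = 0] with a single term. *)
  rewrite (@integral_first_step _ lam eps nu eps0 nuE _ (fun=> f z.2) (fun=> 0) (f z.2) 0 1)//.
  - rewrite !big_ord1 Afun0// mulr0 oppr0 expR0 mulr1 mul0r subrr mulr0 !addr0.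
    by rewrite /newton z0 leNgt Lz.
  - by move=> y y0; apply: big; exact: ltW.
  - move=> y y0 y0'; rewrite big_ord1 mulr0 addr0 Mfun0 ?mulr1 ?big//.
    by rewrite sub0r oppr_ge0.
(* A long gap that stays within [L] moves the count from [r] to [r + 1], and the i-th difference at
   [r + 1] is the one at [r] plus the difference of order [i + 1] at [r]. This fixes [a] and [b]. *)
rewrite (@integral_first_step _ lam eps nu eps0 nuE _ (fun i => fdiffn i f z.2)
    (fun i => fdiffn i.+1 f z.2) (f z.2) (L - z.1) K)//.
(* The sum given by [sum_AB] has one extra term, of index [K], which vanishes below [K eps]. *)
- have zK : L - z.1 < K%:R * eps by rewrite (le_lt_trans _ LK)// gerBl.
  have := @sum_AB _ lam eps eps0 (fun i => fdiffn i f z.2) K (L - z.1).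
  rewrite subr_ge0 => /(_ zL (ltW zK)) ->.
  by rewrite big_ord_recr/= Mfun_ge// mulr0 addr0 /newton z0 zL.
- by rewrite subr_ge0.
- move=> y; rewrite ltrBlDl => Ly; rewrite /newton/step/=.
  by rewrite [_ <= L]leNgt Ly/= !andbF.
- move=> y y0; rewrite lerBrDl => yL; rewrite /newton/step/= yL addr_ge0//= andbT.
  apply: eq_bigr => i _; rewrite opprD addrA; congr (_ * _).
  by case: ifPn => _; rewrite ?mul1r ?mul0r ?addr0// /fdiff [RHS]addrC subrK.
Qed.

(** The first point starts a cluster whatever its gap, so there is no correction [b]: the count is 1
    if the point is at most [L], and 0 otherwise. *)
Lemma newton_init :
  \int[nu]_y newton (y, (y <= L)%R%:R) =
  f 0 * expR (- (lam * L)) + \sum_(i < K) fdiffn i f 1 * Afun lam eps i L.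
Proof.
rewrite (@integral_first_step _ lam eps nu eps0 nuE _ (fun i => fdiffn i f 1)
    (fun=> 0) (f 0) L K)//.
- by rewrite [X in _ + (_ + X)]big1 ?addr0// => i _; rewrite mul0r.
- exact: ltW.
- apply: measurableT_comp; first exact: measurable_newton.
  exact: measurable_init.
- by move=> y Ly; rewrite /newton/= [_ <= L]leNgt Ly/= andbF.
- move=> y y0 yL; rewrite /newton/= y0 yL/=.
  by apply: eq_bigr => i _; rewrite mulr0 addr0.
Qed.

End Remaining.

Definition arrival (T : Type) (R : realType) (E : nat -> T -> R) (k : nat) (w : T)
  : R := \sum_(i < k.+1) E i w.

Lemma measurable_arrival d (T : measurableType d) (R : realType)
    (E : nat -> T -> R) (k : nat) :
  (forall j, measurable_fun setT (E j)) -> measurable_fun setT (arrival E k).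
Proof. by move=> mE; exact: measurable_sum. Qed.

Section Process.
Context d (T : measurableType d) (R : realType) (P : probability T R).
Variables (lam eps L : R) (E : nat -> T -> R).
Hypotheses (lam0 : 0 < lam) (eps0 : 0 < eps) (L0 : 0 < L).
Hypothesis mE : forall j, measurable_fun setT (E j).
Hypothesis lawE : forall j (A : set R), measurable A ->
  P (E j @^-1` A) = exponential_prob lam A.
Hypothesis indE : mutually_independent_RVs P E.
Hypothesis E0 : forall j w, 0 <= E j w.

(* The arrival time [X_k] with the number of cluster starts in [[0, L]] among
   the indices [0..k], counted in [R]. *)
Fixpoint state (k : nat) (w : T) : R * R :=
  if k is k'.+1 then step eps L (state k' w) (E k w)
  else (E 0%N w, (E 0%N w <= L)%R%:R).

Local Notation X := (arrival E).

Lemma state1 k w : (state k w).1 = X k w.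
Proof.
elim: k => [|k ih]; first by rewrite /arrival big_ord1.
by rewrite /arrival big_ord_recr/= ih.
Qed.

Lemma measurable_state k : measurable_fun setT (state k).
Proof.
elim: k => [|k ih]; first exact: (measurableT_comp (measurable_init L)).
apply: (measurableT_comp (g := fun w => (state k w, E k.+1 w))
  (measurable_step eps L)).
exact: measurable_fun_pair.
Qed.

Let cyl (s : seq nat) (B : nat -> set R) := \big[setI/setT]_(j <- s) (E j @^-1` B j).

Let measurable_E j (B : set R) : measurable B -> measurable (E j @^-1` B).
Proof. by move=> mB; rewrite -[X in measurable X]setTI; exact: mE. Qed.

Let measurable_cyl s B : (forall j, measurable (B j)) -> measurable (cyl s B).
Proof. by move=> mB; apply: bigsetI_measurable => j _; exact: measurable_E. Qed.

(** Peels one gap off the joint independence: [B'] prescribes [A] at [k] and agrees with [B] on [s],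
    which is consistent because [k] is not in [s]. *)
Let cyl_cons k s A B : uniq (k :: s) -> measurable A ->
  (forall j, measurable (B j)) ->
  exists2 B', (forall j, measurable (B' j)) &
    cyl (k :: s) B' = E k @^-1` A `&` cyl s B /\
    P (cyl (k :: s) B') = (P (E k @^-1` A) * P (cyl s B))%E.
Proof.
move=> /[dup] uks /= /andP[ks us] mA mB.
pose B' j := if j == k then A else B j.
have mB' j : measurable (B' j) by rewrite /B'; case: ifP.
have sB j : j \in s -> B' j = B j.
  by move=> js; rewrite /B' ifF//; apply/negbTE; apply: contraNneq ks => <-.
exists B' => //; split.
  rewrite /cyl big_cons {1}/B' eqxx; congr (_ `&` _).
  by rewrite big_seq [RHS]big_seq; apply: eq_bigr => j js; rewrite sB.
rewrite /cyl !indE// big_cons {1}/B' eqxx; congr (_ * _)%E.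
by rewrite big_seq [RHS]big_seq; apply: eq_bigr => j js; rewrite sB.
Qed.

(** Induction on [k]. All cylinders over later gaps are treated at once, so that in the step the gap
    [k + 1] can join the cylinder when the hypothesis for [state k] is applied. *)
Lemma state_indep k s B A : uniq s -> (forall j, j \in s -> (k < j)%N) ->
  (forall j, measurable (B j)) -> measurable A ->
  P (state k @^-1` A `&` cyl s B) = (P (state k @^-1` A) * P (cyl s B))%E.
Proof.
elim: k s B A => [|k ih] s B A us ks mB mA.
  have mA' : measurable ((fun y : R => (y, (y <= L)%R%:R) : R * R) @^-1` A).
    by rewrite -[X in measurable X]setTI; exact: (measurable_init L).
  have u0s : uniq (0%N :: s) by rewrite /= us andbT; apply/negP => /ks.
  by have [B' _ [<- ->]] := cyl_cons u0s mA' mB.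
pose U : {mfun T >-> (R * R)%type} := mfun_Sub (mem_set (measurable_state k)).
pose V : {mfun T >-> R} := mfun_Sub (mem_set (mE k.+1)).
pose D := (fun zy => step eps L zy.1 zy.2) @^-1` A.
have mD : measurable D by rewrite -[X in measurable X]setTI; exact: measurable_step.
have uks : uniq (k.+1 :: s) by rewrite /= us andbT; apply/negP => /ks; rewrite ltnn.
apply: (@indep_pair_event _ _ _ T _ _ R P U V _ (cyl s B) _ _ D mD).
- move=> A1 A2 mA1 mA2.
  have [B' mB' [B'E PE]] := cyl_cons (isT : uniq [:: k.+1]) mA2 mB.
  have cyl0 : cyl [::] B = setT by rewrite /cyl big_nil.
  rewrite cyl0 setIT probability_setT mule1 in B'E PE.
  rewrite -B'E; apply: ih => // j.
  by rewrite mem_seq1 => /eqP ->.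
- exact: measurable_cyl.
- move=> A1 A2 mA1 mA2.
  have [B' mB' [B'E PE]] := cyl_cons uks mA2 mB.
  rewrite -setIA -B'E -muleA -PE; apply: ih => // j.
  by rewrite inE => /predU1P[->//|/ks]; exact: ltnW.
Qed.

Let bounded_integrable (g : T -> R) (C : R) : measurable_fun setT g ->
  (forall w, `|g w| <= C) -> P.-integrable setT (EFin \o g).
Proof.
move=> mg gC; apply: measurable_bounded_integrable => //.
  by rewrite (le_lt_trans (probability_le1 _ _))// ltry.
by exists C; split; rewrite ?num_real// => M CM w _; exact: le_trans (gC w) (ltW CM).
Qed.

Variables (f : R -> R) (K : nat).
Hypotheses (LK : L < K%:R * eps).
Hypotheses (mf : measurable_fun setT f) (f1 : forall r, `|f r| <= 1).

Let H := newton lam eps L f K.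

Let mH k : measurable_fun setT (fun w => H (state k w)).
Proof.
exact: (measurableT_comp (measurable_newton _ _ _ _ mf) (measurable_state k)).
Qed.

Let V (j : nat) : {mfun T >-> measurableTypeR R} :=
  @mfun_Sub _ _ T (measurableTypeR R) (E j) (mem_set (mE j)).

Let law (j : nat) : probability (measurableTypeR R) R :=
  distribution P (V j).

Let law_nu j (A : set R) : measurable A -> law j A = exponential_prob lam A.
Proof. by move=> mA; exact: lawE. Qed.

Let EFin_Rintegral_nu j z :
  (\int[law j]_y (H (step eps L z y))%:E = (\int[law j]_y H (step eps L z y))%:E)%E.
Proof.
have [C HC] := newton_bounded K lam0 eps0 L0 f1.
rewrite /Rintegral fineK//; apply: integrable_fin_num => //.
apply: measurable_bounded_integrable => //.
- by rewrite (le_lt_trans (probability_le1 _ _))// ltry.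
- apply: measurableT_comp; first exact: measurable_newton.
  exact: (measurableT_comp (measurable_step eps L) (measurable_pair1 z)).
- by exists C; split; rewrite ?num_real// => M CM w _; exact: le_trans (HC _) (ltW CM).
Qed.

(** Martingale property: [E k.+1] is independent of [state k], so it is integrated out first and
    [newton_harmonic] applies pointwise. *)
Lemma integral_newton_state k :
  (\int[P]_w (H (state k w))%:E = \int[P]_w (H (state 0 w))%:E)%E.
Proof.
have [C HC] := newton_bounded K lam0 eps0 L0 f1.
elim: k => [//|k <-].
pose U : {mfun T >-> (R * R)%type} := mfun_Sub (mem_set (measurable_state k)).
pose g zy := H (step eps L zy.1 zy.2).
have mg : measurable_fun setT g.
  by apply: measurableT_comp; [exact: measurable_newton|exact: measurable_step].
have UV A1 A2 : measurable A1 -> measurable A2 ->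
    P (U @^-1` A1 `&` V k.+1 @^-1` A2) = (P (U @^-1` A1) * P (V k.+1 @^-1` A2))%E.
  move=> mA1 mA2.
  have [B' mB' [B'E PE]] := cyl_cons (isT : uniq [:: k.+1]) mA2 (fun=> measurableT).
  have cyl0 : cyl [::] (fun=> setT) = setT by rewrite /cyl big_nil.
  rewrite cyl0 setIT probability_setT mule1 in B'E PE.
  rewrite -B'E; apply: state_indep => // j.
  by rewrite mem_seq1 => /eqP ->.
have := integral_indep_pair UV mg (fun w => HC (step eps L (U w) (V k.+1 w))).
move=> /= ->; apply: eq_integral => w _.
rewrite [LHS](EFin_Rintegral_nu k.+1 (state k w)); congr EFin.
apply: newton_harmonic => //; first exact: law_nu.
by rewrite state1 /arrival sumr_ge0.
Qed.

Lemma integral_newton_init : \int[P]_w H (state 0 w) =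
  f 0 * expR (- (lam * L)) + \sum_(i < K) fdiffn i f 1 * Afun lam eps i L.
Proof.
have [C HC] := newton_bounded K lam0 eps0 L0 f1.
rewrite -(newton_init K eps0 L0 mf (@law_nu 0%N)) /Rintegral; congr fine.
have mh : measurable_fun setT (fun y : R => H (y, (y <= L)%R%:R)).
  exact: (measurableT_comp (measurable_newton _ _ _ _ mf) (measurable_init L)).
rewrite [RHS]integral_distribution//; first exact/measurable_EFinP.
exact: (bounded_integrable (mH 0) (fun w => HC (state 0 w))).
Qed.

(** Since gaps are nonnegative, [X_k <= L] forces each of the first [k + 1] gaps to be at most [L];
    independence gives the power. *)
Lemma prob_state_le k :
  fine (P [set w | (state k w).1 <= L]) <= (1 - expR (- (lam * L))) ^+ k.+1.
Proof.
have sub : [set w | (state k w).1 <= L] `<=`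
    cyl (iota 0 k.+1) (fun=> `]-oo, L]%classic).
  move=> w; rewrite {1}/mkset state1 => XL; rewrite /cyl -bigcap_seq => j.
  rewrite {1}/mkset mem_iota leq0n add0n => jk;
  rewrite /= in_itv/= (le_trans _ XL)// /arrival.
  by rewrite (bigD1 (Ordinal jk))//= lerDl sumr_ge0.
have m1 : measurable [set w | (state k w).1 <= L].
  rewrite (_ : [set _ | _] = X k @^-1` `]-oo, L]%classic).
    by rewrite -[X in measurable X]setTI; exact: measurable_arrival.
  by apply/seteqP; split => w /=; rewrite state1 in_itv.
have Pc : P (cyl (iota 0 k.+1) (fun=> `]-oo, L]%classic)) =
    ((1 - expR (- (lam * L))) ^+ k.+1)%:E.
  have PL j : P (E j @^-1` `]-oo, L]%classic) = (1 - expR (- (lam * L)))%:E.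
    exact: (exponential_law_le (@law_nu j) (ltW L0)).
  rewrite /cyl indE ?iota_uniq//; under eq_bigr do rewrite PL.
  rewrite -{2}[k.+1](size_iota 0); elim: (iota 0 k.+1) => [|j s ih].
    by rewrite big_nil expr0.
  by rewrite big_cons ih exprS EFinM.
rewrite -lee_fin -Pc fineK ?fin_num_measure//.
by apply: le_measure; rewrite ?inE//; apply: measurable_cyl.
Qed.

Lemma prob_eq_newton (A : set T) : measurable A ->
  (forall k w, L < (state k w).1 -> f (state k w).2 = \1_A w) ->
  P A = (f 0 * expR (- (lam * L)) +
         \sum_(i < K) fdiffn i f 1 * Afun lam eps i L)%:E.
Proof.
move=> mA fA; rewrite -integral_newton_init.
have [C HC] := newton_bounded K lam0 eps0 L0 f1.
rewrite -[LHS]fineK ?fin_num_measure//; congr EFin.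
have m1 k : measurable [set w | (state k w).1 <= L].
  rewrite -[X in measurable X]setTI.
  rewrite (_ : [set _ | _] = (fun w => (state k w).1) @^-1` `]-oo, L]%classic).
    by apply: (measurableT_comp measurable_fst (measurable_state k)).
  by apply/seteqP; split => w /=; rewrite in_itv.
have iA : P.-integrable setT (EFin \o (\1_A : T -> R)) by exact: integrable_indic.
have iH k := bounded_integrable (mH k) (fun w => HC (state k w)).
(* The mean of [H] may be taken at time [k]. Where [X_k > L], [H] equals the indicator of [A];
   elsewhere the two differ by at most [C + 1]. *)
have bound k : `|fine (P A) - \int[P]_w H (state 0 w)| <=
    geometric (C + 1) (1 - expR (- (lam * L))) k.+1.
  have -> : fine (P A) = \int[P]_w \1_A w by rewrite /Rintegral integral_indic ?setIT.
  have -> : \int[P]_w H (state 0 w) = \int[P]_w H (state k w).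
    by rewrite /Rintegral (integral_newton_state k).
  rewrite -RintegralB//.
  apply: (le_trans (le_normr_Rintegral _ _)) => //.
    exact: (integrableB measurableT iA (iH k)).
  have C0 : 0 <= C by rewrite (le_trans _ (HC (0, 0))).
  have i1 : P.-integrable setT (EFin \o (\1_[set w | (state k w).1 <= L] : T -> R)).
    exact: integrable_indic.
  apply: (@le_trans _ _ (\int[P]_w ((C + 1) * \1_[set w | (state k w).1 <= L] w))).
    apply: le_Rintegral => //.
    - exact: (integrable_norm (integrableB measurableT iA (iH k))).
    - exact: (integrableZl measurableT _ i1).
    move=> w _; have [wL|Lw] := leP (state k w).1 L.
      rewrite [X in _ * X]indicE mem_set// mulr1 (le_trans (ler_normB _ _))//.
      by rewrite addrC lerD//= indicE; case: (_ \in _); rewrite ?normr1 ?normr0.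
    rewrite -(fA k)// /H /newton [_ <= L]leNgt Lw andbF subrr normr0.
    by rewrite mulr_ge0 ?addr_ge0// indicE.
  rewrite RintegralZl// ler_wpM2l ?addr_ge0//.
  by rewrite /Rintegral integral_indic// setIT prob_state_le.
apply/eqP; rewrite -subr_eq0 -normr_le0.
have r1 : `|1 - expR (- (lam * L))| < 1.
  have e0 := expR_gt0 (- (lam * L)).
  have e1 : expR (- (lam * L)) <= 1.
    by rewrite -[leRHS]expR0 ler_expR oppr_le0 mulr_ge0// ltW.
  by rewrite ger0_norm ?subr_ge0// ltrBlDr ltrDl.
apply: (ler_cvg_to (cvg_cst _) (cvg_geometric (C + 1) r1)).
(* The bound has exponent [k + 1], so index 0 of the geometric sequence is skipped. *)
by exists 1%N => // -[|k].
Qed.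

Let cs (w : T) (j : nat) : bool := (X j w <= L) && ((j == 0%N) || (eps < E j w)).

Let XB w j : X j.+1 w - X j w = E j.+1 w.
Proof. by rewrite {1}/arrival big_ord_recr/= -/(X j w) addrAC subrr add0r. Qed.

Let csP w j : cs w j <-> cluster_start_le X eps L w j.
Proof.
rewrite /cs /cluster_start_le; split => [/andP[-> h]|[-> h]]; last first.
  case: h => [->//|]; case: j => [|j]//=.
  by rewrite XB => ->.
by split=> //; case: j h => [|j] /= h; [left|right; rewrite XB].
Qed.

Lemma state2 k w : (state k w).2 = (count (cs w) (iota 0 k.+1))%:R.
Proof.
elim: k => [|k ih]; first by rewrite /= /cs /arrival big_ord1 orTb andbT addn0.
rewrite -[k.+2]addn1 iotaD count_cat natrD -ih add0n /= addn0 /cs /=.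
have -> : X k.+1 w = (state k w).1 + E k.+1 w by rewrite state1 /arrival big_ord_recr.
by rewrite andbC; case: ifPn; rewrite ?addr0.
Qed.

(** Arrival times are nondecreasing, so once [X_k > L] every cluster start in [[0, L]] has index at
    most [k]. Any sequence [s] witnessing the event is then a permutation of the filtered
    [iota 0 k.+1]. *)
Lemma beta0'_state n k w : L < X k w ->
  beta0'_eq X eps L n w <-> (state k w).2 = n%:R.
Proof.
move=> LX.
have Xmono : {homo X ^~ w : i j / (i <= j)%N >-> i <= j}.
  apply/nondecreasing_seqP => i; rewrite /arrival [leRHS]big_ord_recr/= lerDl//.
have s0P j : (j \in [seq j <- iota 0 k.+1 | cs w j]) = cs w j.
  rewrite mem_filter mem_iota leq0n add0n.
  case: (boolP (cs w j)) => //= /andP[XL _].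
  rewrite ltnS leqNgt; apply/negP => kj.
  by have := lt_le_trans LX (Xmono _ _ (ltnW kj)); rewrite ltNge XL.
rewrite state2 -size_filter; split => [[s [us <- sP]]|/eqP].
  congr (_%:R); apply/esym; apply: perm_size; apply: uniq_perm => //.
    by rewrite filter_uniq// iota_uniq.
  by move=> j; rewrite s0P; apply/idP/idP => [/sP/csP|/csP/sP].
rewrite eqr_nat => /eqP sn; exists [seq j <- iota 0 k.+1 | cs w j]; split => //.
  by rewrite filter_uniq// iota_uniq.
by move=> j; rewrite s0P; exact: csP.
Qed.

End Process.

(** Finite sequences of naturals are countable, so the event is a countable union, over [s], of
    countable intersections over the indices [k]. *)
Lemma measurable_beta0' d (T : measurableType d) (R : realType)
    (X : nat -> T -> R) (eps L : R) (n : nat) :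
  (forall k, measurable_fun setT (X k)) -> measurable (beta0'_eq X eps L n).
Proof.
move=> mX.
have mS k : measurable [set w | cluster_start_le X eps L w k].
  pose b w := (X k w <= L) && ((k == 0%N) || (eps < X k w - X k.-1 w)).
  have mb : measurable_fun setT b.
    apply: measurable_and; first exact: measurable_fun_ler.
    apply: measurable_or => //; apply: measurable_fun_ltr => //.
    exact: measurable_funB.
  rewrite (_ : [set _ | _] = b @^-1` [set true]).
    by rewrite -[X in measurable X]setTI; exact: mb.
  apply/seteqP; split => w /=; rewrite /cluster_start_le /b.
    by move=> [-> [->|->]]//=; rewrite orbT.
  by move=> /andP[-> /orP[/eqP ->|->]]; split => //; [left|right].
rewrite (_ : beta0'_eq _ _ _ _ = \bigcup_(s : seq nat)
    \bigcap_k [set w | [/\ uniq s, size s = n &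
      (k \in s <-> cluster_start_le X eps L w k)]]); last first.
  apply/seteqP; split => w /=.
    by move=> [s [us sn sP]]; exists s => // k _.
  move=> [s _ h]; exists s.
  have [us sn _] := h 0%N I.
  by split => // k; have [] := h k I.
apply: countable_bigcupT_measurable => [|s]; first exact: countableP.
apply: bigcapT_measurable => k.
have [us|us] := boolP (uniq s); last first.
  by rewrite (_ : [set _ | _] = set0)//; apply/seteqP; split => w // -[].
have [sn|/eqP sn] := eqVneq (size s) n; last first.
  by rewrite (_ : [set _ | _] = set0)//; apply/seteqP; split => w // -[].
have [ks|ks] := boolP (k \in s).
  rewrite (_ : [set _ | _] = [set w | cluster_start_le X eps L w k])//.
  by apply/seteqP; split => w /= => [[_ _ [h _]]|h]; [exact: h|split].
rewrite (_ : [set _ | _] = ~` [set w | cluster_start_le X eps L w k]).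
  exact: measurableC.
by apply/seteqP; split => w /= => [[_ _ [_ h]] /h//|h]; split.
Qed.

Lemma le_measure_null d (T : measurableType d) (R : realType)
    (P : {measure set T -> \bar R}) (A B N : set T) :
  measurable A -> measurable B -> measurable N -> P N = 0%E ->
  A `<=` B `|` N -> (P A <= P B)%E.
Proof.
move=> mA mB mN N0 AB; rewrite -[leRHS]adde0 -N0.
apply: (le_trans _ (measureU2 _ mB mN)).
by apply: le_measure; rewrite ?inE//; exact: measurableU.
Qed.

Lemma eq_beta0' T (R : realType) (X Y : nat -> T -> R) (eps L : R) (n : nat) w :
  (forall k, X k w = Y k w) -> beta0'_eq X eps L n w -> beta0'_eq Y eps L n w.
Proof.
move=> XY [s [us sn sP]]; exists s; split => // k.
by apply: (iff_trans (sP k)); rewrite /cluster_start_le !XY.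
Qed.

(** The density vanishes on negative reals, so truncation at 0 preserves the law. *)
Lemma exponential_prob_max0 (R : realType) (lam : R) (A : set R) :
  exponential_prob lam (Num.max 0 @^-1` A) = exponential_prob lam A.
Proof.
rewrite /exponential_prob integral_mkcond [RHS]integral_mkcond.
apply: eq_integral => y _; rewrite !patchE.
have [y0|y0] := ltP y 0; first by rewrite lt0_exponential_pdf//; do 2 case: ifP.
suff -> : (y \in Num.max 0 @^-1` A) = (y \in A) by [].
by apply/idP/idP; rewrite !inE /= max_r.
Qed.

Theorem theorem6 (R : realType) (d : measure_display) (T : measurableType d)
  (P : probability T R) (lam eps L : R) (X : nat -> T -> R)
  (hlam : 0 < lam) (heps : 0 < eps) (hL : 0 < L)
  (hX : poisson_process_points P lam X) (n : nat) :
  P (beta0'_eq X eps L n) =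
  ((\sum_(n <= i < (Num.truncn (L / eps)).+2)
      (-1) ^+ (i + n) * ('C(i, n))%:R *
      (Gfun lam eps L (i%:Z - 1) + Gfun lam eps L i%:Z)))%:E.
Proof.
have [E [mE lawE indE XE]] := hX.
(* The gaps are nonnegative only almost surely, whereas the chain needs it at every [w]. Truncated
   gaps have the same joint law and differ from [E] only on the null set [N]. *)
pose E' j w := Num.max 0 (E j w).
have mmax : measurable_fun setT (Num.max (0 : R)) by exact: measurable_maxr.
have mE' j : measurable_fun setT (E' j) by exact: (measurableT_comp mmax).
have mmaxB (B : set R) : measurable B -> measurable (Num.max 0 @^-1` B).
  by move=> mB; rewrite -[X in measurable X]setTI; exact: mmax.
have lawE' j (A : set R) : measurable A -> P (E' j @^-1` A) = exponential_prob lam A.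
  by move=> mA; rewrite -exponential_prob_max0 -(lawE j)//; exact: mmaxB.
have indE' : mutually_independent_RVs P E'.
  move=> s B us mB; apply: (indE s (fun j => Num.max 0 @^-1` B j)) => // j.
  exact: mmaxB.
have E'0 j w : 0 <= E' j w by rewrite le_max lexx.
pose X' := arrival E'.
have mX k : measurable_fun setT (X k).
  have -> : X k = arrival E k by apply/funext => w.
  exact: measurable_arrival.
have mX' k : measurable_fun setT (X' k) by exact: measurable_arrival.
have mb := measurable_beta0' eps L n mX.
have mb' := measurable_beta0' eps L n mX'.
pose N : set T := \bigcup_j (E j @^-1` `]-oo, 0[%classic).
have mEneg j : measurable (E j @^-1` `]-oo, 0[%classic).
  by rewrite -[X in measurable X]setTI; exact: mE.
have mN : measurable N by exact: bigcupT_measurable.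
have N0 : P N = 0%E.
  apply/negligibleP => //; apply: negligible_bigcup => j; apply/negligibleP => //.
  apply: etrans; first exact: lawE.
  rewrite /exponential_prob integral0_eq// => y /=.
  by rewrite in_itv/= => y0; rewrite lt0_exponential_pdf.
have XX' w : ~ N w -> forall k, X k w = X' k w.
  move=> Nw k; rewrite XE; apply: eq_bigr => i _; rewrite /E' max_r//.
  by rewrite leNgt; apply/negP => Ei; apply: Nw; exists i => //=; rewrite in_itv.
have -> : P (beta0'_eq X eps L n) = P (beta0'_eq X' eps L n).
  apply/eqP; rewrite eq_le; apply/andP; split.
    apply: (le_measure_null mb mb' mN N0) => w bw.
    have [Nw|/XX' XXw] := pselect (N w); first by right.
    by left; exact: eq_beta0' bw.
  apply: (le_measure_null mb' mb mN N0) => w bw.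
  have [Nw|/XX' XXw] := pselect (N w); first by right.
  by left; apply: eq_beta0' bw => k; rewrite XXw.
(* The least integer with [L < K eps]; the [K + 1] terms indexed by [0..K] reach the upper limit of
   the stated sum. *)
pose K := (Num.truncn (L / eps)).+1.
have LK : L < K%:R * eps.
  by rewrite -ltr_pdivrMr// truncnS_gt.
rewrite (prob_eq_newton hlam heps hL mE' lawE' indE' E'0 LK
  (@measurable_at_nat R n) (@normr_at_nat R n) mb'); last first.
  move=> k w; rewrite state1 => LX; rewrite indicE /at_nat.
  congr (nat_of_bool _)%:R; apply/eqP/idP; rewrite inE.
    by move/(beta0'_state eps E'0 n LX).
  by move/(beta0'_state eps E'0 n LX).
congr EFin; pose a i := fdiffn i (@at_nat R n) 0.
have aE i : a i = (-1) ^+ (i + n) * ('C(i, n))%:R := fdiffn_at_nat i n 0.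
transitivity (\sum_(i < K.+1)
    a i * (Gfun lam eps L (i%:Z - 1) + Gfun lam eps L i%:Z)).
  (* Summation by parts trades differences at 1 for differences at 0, whose values are the signed
     binomials. *)
  rewrite (sum_Gfun lam a (ltW hL) (ltW LK)); congr (_ + _).
  by apply: eq_bigr => i _; rewrite /a fdiffnS subrK add0r.
(* The sum may start at 0, as ['C(i, n) = 0] for [i < n]. *)
rewrite [RHS](big_nat_widenl _ 0)// big_mkord [RHS]big_mkcond/=.
apply: eq_bigr => i _; rewrite aE; case: leqP => // ni.
by rewrite bin_small// mulr0 mul0r.
Qed.
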